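(* Any generalized Pisot toral automorphism has Property S. That is, if $m\ge2$ and $T:\mathbb{T}^m\to\mathbb{T}^m$ is a generalized Pisot automorphism, then the dynamical system $(\mathbb{T}^m,\mathcal{H}_m,T)$ possesses Property S.
   Context: $\mathbb{T}^m=\mathbb{R}^m/\mathbb{Z}^m$ and $\mathcal{H}_m$ is the (normalized) Haar measure on $\mathbb{T}^m$. For an $m\times m$ integer matrix $M$ with determinant $\pm1$, $T_M:\mathbb{T}^m\to\mathbb{T}^m$ is the automorphism $T_M x=Mx\bmod\mathbb{Z}^m$. $T_M$ is a Pisot automorphism if the characteristic polynomial of $M$ is irreducible over $\mathbb{Q}$, has one real root $\beta>1$, and all its other roots have modulus less than $1$. An automorphism $T$ of $\mathbb{T}^m$ is generalized Pisot if one of $T,-T,T^{-1},-T^{-1}$ is Pisot. Property S: let $X$ be a compact metric space, $T:X\to X$ a continuous invertible map and $\mu$ an ergodic $T$-invariant probability measure. The system $(X,\mu,T)$ possesses Property S if for any $\epsilon>0$ there exists an open connected subset $A$ of $X$ such that (1) $\mu(A)<\epsilon$; (2) for all $x\in X$ except, possibly, a countable set, there exists $n=n(x)\in\mathbb{Z}$ such that $T^n x\in A$. *)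

(* Defs.v *)
From HB Require Import structures.
From mathcomp Require Import all_boot all_order all_algebra.
From mathcomp Require Import ring_quotient.
From mathcomp Require Import all_classical all_reals all_analysis.
From mathcomp.real_closed Require Import complex.
From mathcomp Require Import ring.
Set Implicit Arguments.
Unset Strict Implicit.
Unset Printing Implicit Defensive.
Import Order.TTheory GRing.Theory Num.Theory.
Import numFieldNormedType.Exports.
Local Open Scope classical_set_scope.
Local Open Scope ring_scope.
Local Open Scope quotient_scope.

Section dist_to_int.
Context {R : realType}.
Implicit Types (t s : R) (k : int).

(* distance from t to the nearest integer *)
Definition dZ t : R :=
  Num.min (t - (Num.floor t)%:~R) ((Num.floor t)%:~R + 1 - t).

Lemma dZ_le t k : dZ t <= `|t - k%:~R|.
Proof.
rewrite /dZ ge_min; have [kt|tk] := leP (k%:~R) t.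
  have kf : k <= Num.floor t by rewrite Num.Theory.floor_ge_int_tmp ?num_real.
  apply/orP; left; rewrite ger0_norm ?subr_ge0// lerD2l lerN2 ler_int//.
have fk : Num.floor t + 1 <= k.
  rewrite lezD1 -(ltr_int R) (le_lt_trans _ tk)//.
  by rewrite Num.Theory.floor_le_tmp ?num_real.
apply/orP; right; rewrite ltr0_norm ?subr_lt0// opprB lerD2r -(intrD _ _ 1) ler_int//.
Qed.

Lemma dZ_ex t : exists k, dZ t = `|t - k%:~R|.
Proof.
have f1 : (Num.floor t)%:~R <= t by rewrite Num.Theory.floor_le_tmp ?num_real.
have f2 : t < (Num.floor t)%:~R + 1.
  by rewrite -(intrD _ _ 1) Num.Theory.floorD1_gt ?num_real.
rewrite /dZ /Num.min; case: ifP => _.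
  by exists (Num.floor t); rewrite ger0_norm ?subr_ge0.
exists (Num.floor t + 1); rewrite intrD ltr0_norm ?opprB//.
by rewrite subr_lt0.
Qed.

Lemma dZ_ge0 t : 0 <= dZ t. Proof. by have [k ->] := dZ_ex t. Qed.

Lemma dZ_int t : t \is a Num.int -> dZ t = 0.
Proof.
move=> /intrP[k ->]; apply/eqP; rewrite eq_le dZ_ge0 andbT.
by rewrite (le_trans (dZ_le _ k))// subrr normr0.
Qed.

Lemma dZ_eq0 t : dZ t = 0 -> t \is a Num.int.
Proof.
have [k ->] := dZ_ex t => /normr0_eq0/eqP; rewrite subr_eq0 => /eqP ->.
exact: intr_int.
Qed.

Lemma dZN t : dZ (- t) = dZ t.
Proof.
suff le s : dZ (- s) <= dZ s by apply/eqP; rewrite eq_le le -{1}(opprK t) le.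
have [k ->] := dZ_ex s; rewrite (le_trans (dZ_le _ (- k)))//.
by rewrite intrN -opprD normrN.
Qed.

Lemma dZD t s : dZ (t + s) <= dZ t + dZ s.
Proof.
have [k ->] := dZ_ex t; have [l ->] := dZ_ex s.
by rewrite (le_trans (dZ_le _ (k + l)))// intrD opprD addrACA ler_normD.
Qed.

End dist_to_int.

Section torus.
Context {R : realType} {m : nat}.

Definition intvec : {pred 'cV[R]_m} :=
  [pred v : 'cV[R]_m | [forall i : 'I_m, v i 0 \is a Num.int]%B].

Lemma intvecP (v : 'cV[R]_m) :
  reflect (forall i, v i 0 \is a Num.int) (v \in intvec).
Proof. exact: forallP. Qed.

Fact intvec_zmod_closed : zmod_closed intvec.
Proof.
split=> [|u v /intvecP hu /intvecP hv]; apply/intvecP => i;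
  rewrite !mxE ?rpred0//.
exact: rpredB.
Qed.
HB.instance Definition _ := GRing.isZmodClosed.Build _ intvec intvec_zmod_closed.
End torus.
Arguments intvec R m : clear implicits.

Definition torus (R : realType) (m : nat) : Type := Quotient.quot (intvec R m).

#[short(type="pmetricType")]
HB.structure Definition PointedMetric (K : numDomainType) :=
  {M of Metric K M & Pointed M}.

Section torus_structure.
Context {R : realType} {m : nat}.
Local Notation T := (torus R m).
Implicit Types (x y z : T) (u v : 'cV[R]_m).

HB.instance Definition _ := GRing.Zmodule.on T.
HB.instance Definition _ := EqQuotient.on T.
HB.instance Definition _ := isPointed.Build T 0.

Lemma torus_piP u v :
  reflect (forall i, u i 0 - v i 0 \is a Num.int) (\pi_T u == \pi_T v).
Proof.
rewrite -Quotient.idealrBE; apply: (iffP (intvecP _)) => h i;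
  by have := h i; rewrite !mxE.
Qed.

Definition torus_dist x y : R :=
  \big[Num.max/0]_(i < m) dZ ((repr x) i 0 - (repr y) i 0).

Lemma torus_distE u v :
  torus_dist (\pi_T u) (\pi_T v) = \big[Num.max/0]_(i < m) dZ (u i 0 - v i 0).
Proof.
apply: eq_bigr => i _.
have /torus_piP/(_ i) hu : \pi_T (repr (\pi_T u)) == \pi_T u by rewrite reprK.
have /torus_piP/(_ i) hv : \pi_T (repr (\pi_T v)) == \pi_T v by rewrite reprK.
suff le (a a' b b' : R) : a - a' \is a Num.int -> b - b' \is a Num.int ->
    dZ (a - b) <= dZ (a' - b').
  by apply/eqP; rewrite eq_le !le// -opprB rpredN.
move=> ha hb; have -> : a - b = (a' - b') + ((a - a') - (b - b')) by ring.
by rewrite (le_trans (dZD _ _))// (dZ_int (rpredB ha hb)) addr0.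
Qed.

Lemma torus_dist_ge i x y : dZ ((repr x) i 0 - (repr y) i 0) <= torus_dist x y.
Proof. exact: le_bigmax_cond. Qed.

Lemma torus_dist_ge0 x y : 0 <= torus_dist x y.
Proof. exact: bigmax_ge_id. Qed.

Lemma torus_distxx x : torus_dist x x = 0.
Proof.
apply/eqP; rewrite eq_le torus_dist_ge0 andbT; apply: bigmax_le => // i _.
by rewrite subrr dZ_int ?rpred0.
Qed.

Lemma torus_dist_eq0 x y : torus_dist x y = 0 -> x = y.
Proof.
move=> d0; apply/eqP; rewrite -[x]reprK -[y]reprK; apply/torus_piP => i.
by apply/dZ_eq0/eqP; rewrite eq_le dZ_ge0 andbT -d0 torus_dist_ge.
Qed.

Lemma torus_dist_sym x y : torus_dist x y = torus_dist y x.
Proof. by apply: eq_bigr => i _; rewrite -dZN opprB. Qed.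

Lemma torus_dist_triangle y x z :
  torus_dist x z <= torus_dist x y + torus_dist y z.
Proof.
apply: bigmax_le => [|i _]; first by rewrite addr_ge0// torus_dist_ge0.
rewrite (le_trans _ (lerD (torus_dist_ge i x y) (torus_dist_ge i y z)))//.
by rewrite (le_trans _ (dZD _ _))// addrA subrK.
Qed.

HB.instance Definition _ := isMetric.Build R T
  torus_distxx torus_dist_eq0 torus_dist_sym torus_dist_triangle.

(* The metric topology is the quotient topology of R^m / Z^m. *)
Lemma torus_openE (U : set T) : open U <-> open (\pi_T @^-1` U).
Proof.
rewrite !openE; split => oU.
  move=> u /= /oU; rewrite /interior => /nbhs_ballP[e /= e0 eU].
  apply/nbhs_ballP; exists e => //= v [_ uv]; apply: eU.
  rewrite ballEmdist /= [mdist _ _]torus_distE; apply: bigmax_lt => // i _.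
  rewrite (le_lt_trans (dZ_le _ 0))// subr0.
  exact: uv.
move=> x; rewrite -{1}[x]reprK => /oU /nbhs_ballP[e /= e0 eU].
apply/nbhs_ballP; exists e => //= y; rewrite ballEmdist /= => xy.
pose v := \col_i ((repr y) i 0 +
  (projT1 (cid (dZ_ex ((repr x) i 0 - (repr y) i 0))))%:~R).
have -> : y = \pi_T v.
  apply/eqP; rewrite -[y]reprK; apply/torus_piP => i; rewrite mxE opprD addrA.
  by rewrite subrr sub0r rpredN intr_int.
apply: eU; split => // i j; rewrite /ball /= ord1 mxE opprD addrA.
case: cid => k /= <-; apply: le_lt_trans xy; exact: torus_dist_ge.
Qed.

End torus_structure.

Section toral_maps.
Context {R : realType} {m : nat}.
Local Notation T := (torus R m).
Implicit Types (M : 'M[int]_m) (F : T -> T).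

Definition toral_map M (x : T) : T := \pi_T (map_mx intr M *m repr x).

Lemma toral_mapE M (v : 'cV[R]_m) :
  toral_map M (\pi_T v) = \pi_T (map_mx intr M *m v).
Proof.
have /torus_piP rv : \pi_T (repr (\pi_T v)) == \pi_T v by rewrite reprK.
apply/eqP/torus_piP => i; rewrite !mxE -sumrB rpred_sum// => j _.
by rewrite -mulrBr !mxE rpredM ?intr_int// -!(ord1 0) rv.
Qed.

Definition toral_automorphism F :=
  exists2 M, \det M = 1 \/ \det M = -1 & F = toral_map M.

Definition pisot_char_poly M :=
  irreducible_poly (map_poly intr (char_poly M) : {poly rat}) /\
  exists beta : R,
    [/\ 1 < beta,
        root (map_poly intr (char_poly M)) beta &
        forall z : R[i], root (map_poly intr (char_poly M)) z ->
          z != (beta%:C)%C -> `|z| < 1].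

Definition pisot_automorphism F :=
  exists M, [/\ \det M = 1 \/ \det M = -1, F = toral_map M & pisot_char_poly M].

Definition opp_map F : T -> T := fun x => - F x.

Definition generalized_pisot F :=
  toral_automorphism F /\
  exists Finv, [/\ cancel F Finv, cancel Finv F &
    [\/ pisot_automorphism F, pisot_automorphism (opp_map F),
        pisot_automorphism Finv | pisot_automorphism (opp_map Finv)]].

End toral_maps.

Definition borel {R : realType} (X : pmetricType R) : Type :=
  g_sigma_algebraType (@open X).
HB.instance Definition _ (R : realType) (X : pmetricType R) :=
  Measurable.on (borel X).

(* H_m, through its characterization as the unique translation-invariant Borel
   probability measure on the torus. *)
Definition haar_measure {R : realType} {m : nat}
    (mu : probability (borel (torus R m)) R) :=
  forall (a : torus R m) (A : set (torus R m)),
    measurable (A : set (borel (torus R m))) -> mu [set a + x | x in A] = mu A.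

Section property_S.
Context {R : realType} {X : pmetricType R}.
Variables (mu : probability (borel X) R) (T : X -> X).

Definition measure_preserving :=
  forall A : set (borel X), measurable A -> mu (T @^-1` A) = mu A.

Definition ergodic :=
  forall A : set (borel X), measurable A -> T @^-1` A = A ->
    mu A = 0%E \/ mu A = 1%E.

Definition iterz (Tinv : X -> X) (n : int) : X -> X :=
  match n with Posz k => iter k T | Negz k => iter k.+1 Tinv end.

(* Property S is only defined for an ergodic invariant measure of an invertible
   continuous map of a compact metric space; these standing assumptions are
   part of the predicate. *)
Definition property_S :=
  [/\ compact [set: X], continuous T, measure_preserving & ergodic] /\
  exists Tinv, [/\ cancel T Tinv, cancel Tinv T &
    forall eps : R, 0 < eps ->
      exists A : set X,
        [/\ open A, connected A, (mu A < eps%:E)%E &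
            countable [set x | ~ exists n : int, A (iterz Tinv n x)]]].

End property_S.

(* Main.v *)
(* Ergodicity. If A is T-invariant, the measure of the part of A that the
   translation by a moves out of A does not change when a is replaced by T a, and
   it tends to 0 with a.  It therefore vanishes for a in the stable or the
   unstable direction of T; these span R^m, so A is almost invariant under every
   translation, and Fubini gives mu(A) mu(A^c) = 0.

   Property S. Let U be a thin slab around a coordinate hyperplane.  By
   ergodicity the points whose orbit avoids U form a closed null set Z, which
   has neighbourhoods of arbitrarily small measure.  Joining the components of
   such a neighbourhood to U by finitely many thin slabs transversal to U gives
   an open connected set of small measure that contains U and Z, hence meets
   every orbit. *)

Require Import Defs.
From mathcomp Require Import all_boot all_order all_algebra.
From mathcomp Require Import all_classical all_reals all_analysis.
From mathcomp Require Import ring_quotient measurable_realfun.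
From mathcomp.real_closed Require Import complex polyorder.
From mathcomp Require Import ring lra zify.
Set Implicit Arguments.
Unset Strict Implicit.
Unset Printing Implicit Defensive.
Import Order.TTheory GRing.Theory Num.Theory.
Import numFieldNormedType.Exports.
Local Open Scope classical_set_scope.
Local Open Scope ring_scope.
Local Open Scope quotient_scope.

(** * Topology of the torus *)

Section torus_topology.
Context {R : realType} {m : nat}.
Local Notation T := (torus R m).
Implicit Types (x y a : T) (u v : 'cV[R]_m).

Definition tproj v : T := \pi_T v.

Lemma tprojD : {morph tproj : u v / u + v}.
Proof. exact: (@raddfD _ _ (\pi_T)). Qed.

Lemma tproj0 : tproj 0 = 0.
Proof. exact: (@raddf0 _ _ (\pi_T)). Qed.

Lemma tproj_surj x : exists v, x = tproj v.
Proof. by exists (repr x); rewrite /tproj reprK. Qed.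

Lemma tproj_eqP u v :
  tproj u = tproj v <-> forall i, u i 0 - v i 0 \is a Num.int.
Proof. by split=> [/eqP/torus_piP|/torus_piP/eqP]. Qed.

Lemma mdist_tproj u v :
  mdist (tproj u) (tproj v) = \big[Num.max/0]_(i < m) dZ (u i 0 - v i 0).
Proof. exact: torus_distE. Qed.

Lemma mdist_tproj_le u v : mdist (tproj u) (tproj v) <= `|u - v|.
Proof.
rewrite mdist_tproj; apply: bigmax_le => // i _.
rewrite (le_trans (dZ_le _ 0))// subr0.
by have := le_bigmax 0 (fun ij => `|(u - v) ij.1 ij.2|) (i, 0);
   rewrite -mx_normrE /= !mxE.
Qed.

Lemma mdist_sym x y : mdist x y = mdist y x.
Proof. exact: metric_sym. Qed.

Lemma mdist_triangle y x z : mdist x z <= mdist x y + mdist y z.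
Proof. exact: metric_triangle. Qed.

Lemma mdistDr a x y : mdist (x + a) (y + a) = mdist x y.
Proof.
have [u ->] := tproj_surj x; have [v ->] := tproj_surj y.
have [w ->] := tproj_surj a.
rewrite -!tprojD !mdist_tproj; apply: eq_bigr => i _; congr dZ.
by rewrite !mxE; ring.
Qed.

Lemma mdistDD x y x' y' : mdist (x + y) (x' + y') <= mdist x x' + mdist y y'.
Proof.
apply: le_trans (mdist_triangle (x' + y) _ _) _.
by rewrite mdistDr ![x' + _]addrC mdistDr.
Qed.

Lemma mdistNN x y : mdist (- x) (- y) = mdist x y.
Proof.
have := mdistDr (x + y) (- x) (- y).
by rewrite addrA addNr add0r addrCA addNr addr0 mdist_sym => ->.
Qed.

Lemma open_tprojE (U : set T) : open U <-> open (tproj @^-1` U).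
Proof. exact: torus_openE. Qed.

Lemma tproj_continuous : continuous tproj.
Proof. by apply/continuousP => U /open_tprojE. Qed.

Lemma open_torusP (U : set T) :
  open U <-> forall x, U x -> exists2 e : R, 0 < e & ball x e `<=` U.
Proof.
rewrite openE; split => oU x /oU; first by move=> /nbhs_ballP[e /= e0 eU]; exists e.
by move=> [e e0 eU]; apply/nbhs_ballP; exists e.
Qed.

Lemma open_ball_torus x (e : R) : open (ball x e).
Proof.
apply/open_torusP => y; rewrite ballEmdist/= => xy.
exists (e - mdist x y); first by rewrite subr_gt0.
move=> z; rewrite !ballEmdist/= ltrBrDl; apply: le_lt_trans.
exact: mdist_triangle.
Qed.

Lemma addr_torus_continuous a : continuous (fun x => x + a).
Proof.
apply/continuousP => U /open_torusP oU; apply/open_torusP => x /= /oU[e e0 eU].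
exists e => // y; rewrite ballEmdist/= => xy; apply: eU.
by rewrite ballEmdist/= mdistDr.
Qed.

Lemma oppr_torus_continuous : continuous (fun x : T => - x).
Proof.
apply/continuousP => U /open_torusP oU; apply/open_torusP => x /= /oU[e e0 eU].
exists e => // y; rewrite ballEmdist/= => xy; apply: eU.
by rewrite ballEmdist/= mdistNN.
Qed.

(** The torus is the continuous image of the unit cube, here a cube of row vectors that is
    transposed before projecting. *)
Lemma torus_compact : compact [set: T].
Proof.
pose K : set 'rV[R]_m := [set v | forall i, `[0, 1]%classic (v 0 i)].
have cK : compact K.
  by apply: (@rV_compact R m (fun=> `[0, 1]%classic)) => i; exact: segment_compact.
have -> : [set: T] = (tproj \o trmx) @` K.
  apply/seteqP; split=> // x _; have [v ->] := tproj_surj x.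
  exists (\row_i (v i 0 - (Num.floor (v i 0))%:~R)).
    move=> i /=; rewrite mxE in_itv/= subr_ge0 Num.Theory.floor_le//=.
    by rewrite lerBlDl -(intrD _ _ 1) ltW// Num.Theory.floorD1_gt.
  apply/tproj_eqP => i; rewrite !mxE addrAC subrr add0r rpredN.
  exact: intr_int.
apply: continuous_compact cK; apply: continuous_subspaceT => v.
apply: continuous_comp; last exact: tproj_continuous.
move=> A /nbhs_ballP[e /= e0 eA]; apply/nbhs_ballP; exists e => //= w [_ vw].
by apply: eA; split => // i j; rewrite !mxE; exact: vw.
Qed.

End torus_topology.

Lemma rat_approx {R : realType} (t e : R) : 0 < e ->
  exists q : rat, `|ratr q - t| < e.
Proof.
move=> e0; have /rat_in_itvoo[q] : t - e < t + e by lra.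
by rewrite in_itv/= => /andP[h1 h2]; exists q; rewrite ltr_norml; lra.
Qed.

(** * Haar measure *)

Section borel_torus.
Context {R : realType} {m : nat}.
Local Notation T := (torus R m).
Local Notation B := (borel T).

Lemma borel_open (U : set T) : open U -> measurable (U : set B).
Proof. exact: sub_sigma_algebra. Qed.

Lemma borel_measurable_fun d (X : measurableType d) (f : X -> B) :
  (forall U : set T, open U -> measurable (f @^-1` U)) ->
  measurable_fun [set: X] f.
Proof.
move=> fo; apply: (@measurability _ _ X B setT f (@open T)) => // _ [U oU <-].
by rewrite setTI; exact: fo.
Qed.

Lemma continuous_measurable_torus (f : T -> T) :
  continuous f -> measurable_fun [set: B] (f : B -> B).
Proof.
move=> /continuousP cf; apply: borel_measurable_fun => U oU.
by apply: borel_open; exact: cf.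
Qed.

Let ratpt (q : 'cV[rat]_m) : T := tproj (map_mx ratr q).

Lemma ratpt_dense (x : T) (e : R) : 0 < e -> exists q, mdist (ratpt q) x < e.
Proof.
move=> e0; have [v ->] := tproj_surj x.
pose q : 'cV[rat]_m := \col_i projT1 (cid (rat_approx (v i 0) e0)).
exists q; rewrite mdist_tproj; apply: bigmax_lt => // i _.
rewrite (le_lt_trans (dZ_le _ 0))// subr0 !mxE.
by case: cid.
Qed.

(** Joint measurability for the product of the two Borel sigma-algebras: the preimage of an open set
    is a countable union of products of balls with rational centres and radii [1/(n+1)]. *)
Lemma measurable_addr_torus :
  measurable_fun [set: B * B] (fun z => (z.1 : T) + (z.2 : T) : B).
Proof.
apply: borel_measurable_fun => U oU.
pose I := ('cV[rat]_m * 'cV[rat]_m * nat)%type.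
pose good (i : I) := forall x y : T, mdist (ratpt i.1.1) x < i.2.+1%:R^-1 ->
  mdist (ratpt i.1.2) y < i.2.+1%:R^-1 -> U (x + y).
pose F (i : I) : set (B * B) := if `[< good i >] then
  ball (ratpt i.1.1) (i.2.+1%:R^-1 : R) `*` ball (ratpt i.1.2) (i.2.+1%:R^-1 : R)
  else set0.
have -> : (fun z : B * B => (z.1 : T) + (z.2 : T)) @^-1` U = \bigcup_i F i.
  apply/seteqP; split => [[x y] /= Uxy | [x y] [i _]]; last first.
    rewrite /F; case: ifP => [/asboolP gi|//] [] /=.
    by rewrite !ballEmdist/=; exact: gi.
  have [e e0 eU] := (open_torusP _).1 oU _ Uxy.
  (* Each of the two coordinates may move by two radii, so four radii below [e / 4] keep the sum
     inside the ball of radius [e]. *)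
  have e40 : 0 < e / 4 by lra.
  have [n _ nP] := near_infty_natSinv_lt (PosNum e40).
  have {nP} ne : n.+1%:R^-1 < e / 4 by apply: nP => /=.
  have n0 : 0 < n.+1%:R^-1 :> R by [].
  have [p xp] := ratpt_dense x n0; have [q yq] := ratpt_dense y n0.
  exists (p, q, n) => //; rewrite /F asboolT; first by split; rewrite /= ballEmdist/=.
  move=> x' y' /= px' qy'; apply: eU; rewrite ballEmdist/=.
  apply: le_lt_trans (mdistDD _ _ _ _) _.
  have := mdist_triangle (ratpt p) x x'; have := mdist_triangle (ratpt q) y y'.
  rewrite (mdist_sym x (ratpt p)) (mdist_sym y (ratpt q)).
  move: (mdist x x') (mdist y y') (mdist (ratpt p) x) (mdist (ratpt p) x')
    (mdist (ratpt q) y) (mdist (ratpt q) y') (n.+1%:R^-1) xp yq px' qy' ne.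
  by move=> *; lra.
apply: countable_bigcupT_measurable; first exact: countableP.
move=> i; rewrite /F; case: ifP => _ //.
by apply: measurableX; apply: borel_open; exact: open_ball_torus.
Qed.

End borel_torus.

Section haar.
Context {R : realType} {m : nat}.
Local Notation T := (torus R m).
Local Notation B := (borel T).
Variable mu : probability (borel (torus R m)) R.
Hypothesis hmu : haar_measure mu.

Lemma haar_preimageDr (a : T) (A : set B) : measurable A ->
  mu ((fun x : T => x + a) @^-1` A) = mu A.
Proof.
move=> mA; rewrite -(hmu (- a) mA); congr (mu _).
apply/seteqP; split => [x /= Ax|_ [x Ax <-]] /=.
  by exists (x + a) => //; rewrite addrC addrK.
by rewrite addrC addrA subrr add0r.
Qed.

Lemma haar_preimageDl (a : T) (A : set B) : measurable A ->
  mu ((fun x : T => a + x) @^-1` A) = mu A.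
Proof.
move=> mA; rewrite -[RHS](haar_preimageDr a mA); congr (mu _).
by apply/funext => x /=; rewrite addrC.
Qed.

(** Both iterated integrals compute the product measure of [S], by uniqueness of that measure. *)
Lemma haar_fubini (S : set (B * B)) : measurable S ->
  (\int[mu]_x mu (xsection S x) = \int[mu]_y mu (ysection S y))%E.
Proof.
move=> mS; transitivity ((mu \x^ mu)%E S) => //.
by apply: product_measure_unique => //= *; rewrite product_measure2E.
Qed.

End haar.

(** * Continuity of a measure from above *)

Section small_measure.
Local Open Scope ereal_scope.
Context d (X : measurableType d) {R : realType} (mu : probability X R).

Lemma small_measure_bigcap (F : (set X)^nat) (e : R) :
  (forall i, measurable (F i)) -> nonincreasing_seq F ->
  mu (\bigcap_n F n) = 0 -> (0 < e)%R -> exists n, mu (F n) < e%:E.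
Proof.
move=> mF niF F0 e0.
have cF : mu \o F @ \oo --> 0.
  rewrite -F0; apply: nonincreasing_cvg_mu => //; last exact: bigcapT_measurable.
  by rewrite (le_lt_trans (probability_le1 _ _))// ltry.
have /fine_cvgP[[N _ fN] /cvgrPdist_lt/(_ _ e0)[N' _ N'P]] := cF.
exists (maxn N N').
have := N'P _ (leq_maxr N N'); have := fN _ (leq_maxl N N').
rewrite /= sub0r normrN => Ffin h.
rewrite -[mu _]fineK// lte_fin; exact: le_lt_trans (ler_norm _) h.
Qed.

End small_measure.

(** * Invariance under endomorphisms and a zero-one criterion *)

Section torus_endomorphisms.
Context {R : realType} {m : nat}.
Local Notation T := (torus R m).
Local Notation B := (borel T).
Variable mu : probability (borel (torus R m)) R.
Hypothesis hmu : haar_measure mu.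

Local Open Scope ereal_scope.

(** Apply Fubini to the pairs with [F x + y] in [A]: the sections at fixed [x] are translates of
    [A], and those at fixed [y = F b] are translates of the preimage of [A]. Injectivity is not
    assumed, so multiplication by [n] is covered too. *)
Lemma haar_invariant_endo (F : T -> T) :
  {morph F : x y / (x + y)%R} -> continuous F -> (forall y, exists x, F x = y) ->
  measure_preserving mu F.
Proof.
move=> FD cF sF A mA.
pose S : set (B * B) := [set z | A (F z.1 + z.2)%R].
have mS : measurable S.
  have mf : measurable_fun [set: B * B] (fun z => (F z.1, z.2) : B * B).
    apply/measurable_fun_pairP; split; last exact: measurable_snd.
    by apply: measurableT_comp measurable_fst; exact: continuous_measurable_torus.
  have := measurableT_comp (measurable_addr_torus (R := R) (m := m)) mf.
  by move=> /(_ measurableT A mA); rewrite setTI.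
have := haar_fubini mu mS.
rewrite (eq_integral (cst (mu A))); last first.
  move=> x _ /=; rewrite -[RHS](haar_preimageDl hmu (F x) mA); congr (mu _).
  by apply/seteqP; split=> y; rewrite /xsection/= inE.
rewrite [RHS](eq_integral (cst (mu (F @^-1` A)))); last first.
  move=> y _ /=; have [b <-] := sF y.
  have mFA : measurable (F @^-1` A : set B).
    by have := continuous_measurable_torus cF measurableT mA; rewrite setTI.
  rewrite -[RHS](haar_preimageDr hmu b mFA); congr (mu _).
  by apply/seteqP; split=> x; rewrite /ysection/= inE /S/= FD.
have muT : mu [set: B] = 1 := probability_setT mu.
by rewrite !integral_cst// => h; rewrite -[LHS]mule1 -[RHS]mule1 -muT; exact: esym h.
Qed.

Definition shift_out (A : set T) (a : T) : set B := [set x | A x /\ ~ A (x + a)%R].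

Lemma measurable_shift (A : set B) (a : T) :
  measurable A -> measurable ([set x | A (x + a)%R] : set B).
Proof.
move=> mA.
by have := continuous_measurable_torus (@addr_torus_continuous R m a) measurableT mA;
  rewrite setTI.
Qed.

Lemma measurable_shift_out (A : set B) (a : T) :
  measurable A -> measurable (shift_out A a).
Proof.
by move=> mA; apply: measurableI => //; apply: measurableC; exact: measurable_shift.
Qed.

Lemma haar_zero_one (A : set B) : measurable A ->
  (forall a, mu (shift_out A a) = 0) -> mu A = 0 \/ mu A = 1.
Proof.
move=> mA A0.
pose S : set (B * B) := [set z | A z.1 /\ ~ A ((z.1 : T) + (z.2 : T))%R].
have mS : measurable S.
  apply: measurableI; first by rewrite -[X in measurable X]setTI; exact: measurable_fst.
  apply: measurableC; rewrite -[X in measurable X]setTI.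
  exact: measurable_addr_torus.
have := haar_fubini mu mS; rewrite [RHS]integral0_eq; last first.
  move=> y _ /=; rewrite -(A0 y); congr (mu _).
  by apply/seteqP; split=> x; rewrite /ysection/= inE.
rewrite (eq_integral (fun x => mu (~` A) * (\1_A x)%:E)); last first.
  move=> x _ /=; rewrite indicE; have [xA|xA] := boolP (x \in A).
    rewrite mule1 -(haar_preimageDl hmu (x : T) (measurableC mA)); congr (mu _).
    apply/seteqP; split=> y; rewrite /xsection/= inE /S/=; first by case.
    by split => //; exact: set_mem.
  rewrite mule0 (_ : xsection _ _ = set0) ?measure0//.
  by apply/seteqP; split => y //; rewrite /xsection/= inE /S/= => -[/mem_set];
     rewrite (negbTE xA).
rewrite ge0_integralZl//; last by apply/measurable_EFinP; exact: measurable_indic.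
rewrite integral_indic// setIT => /eqP; rewrite mule_eq0.
move=> /orP[|] /eqP h; last by left.
right; have := probability_setC mu mA; rewrite h.
have := fin_num_measure mu _ mA; case: (mu A) => //= r _ [] /eqP.
by rewrite eq_sym subr_eq0 => /eqP <-.
Qed.

End torus_endomorphisms.

(** * Ergodicity from a stable/unstable splitting *)

Section translation_continuity.
Context {R : realType} {m : nat}.
Local Notation T := (torus R m).
Local Notation B := (borel T).
Variable mu : probability (borel (torus R m)) R.
Hypothesis hmu : haar_measure mu.

Local Open Scope ereal_scope.

Definition shift_continuous (A : set T) := forall e : R, (0 < e)%R ->
  exists2 d : R, (0 < d)%R &
    forall a : T, (mdist a 0 < d)%R -> mu (shift_out A a) < e%:E.

(** A point moved out of [U] by a translation shorter than [1/(n+1)] lies in [U] within that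
    distance of the complement. These boundary layers decrease to the empty set. *)
Lemma shift_continuous_open (U : set T) : open U -> shift_continuous U.
Proof.
move=> oU e e0.
pose N (n : nat) : set T := \bigcup_(y in ~` U) ball y (n.+1%:R^-1 : R).
have oN n : open (N n) by apply: bigcup_open => y _; exact: open_ball_torus.
pose F n : set B := U `&` N n.
have mF n : measurable (F n).
  by apply: measurableI; apply: borel_open.
have [|||n Fn] := @small_measure_bigcap _ B R mu F e mF.
- move=> p q pq; apply/subsetPset => x [Ux [y Uy xy]]; split=> //; exists y => //.
  by apply: le_ball xy; rewrite lef_pV2 ?posrE ?ltr0n// ler_nat ltnS.
- rewrite (_ : \bigcap_n _ = set0) ?measure0//.
  apply/seteqP; split=> // x FI.
  have [Ux _] := FI 0%N I.
  have [r r0 rU] := (open_torusP _).1 oU _ Ux.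
  have [n _ nP] := near_infty_natSinv_lt (PosNum r0).
  have [_ [y Uy xy]] := FI n I; apply: Uy; apply: rU; apply: ball_sym.
  by apply: le_ball xy; apply/ltW/nP => /=.
- exact: e0.
exists (n.+1%:R^-1)%R; first by [].
move=> a an; apply: le_lt_trans Fn; apply: le_measure; rewrite ?inE//.
  by apply: measurable_shift_out; exact: borel_open.
move=> x [Ux Uxa]; split=> //; exists (x + a)%R => //.
by rewrite ballEmdist/= -[X in mdist _ X]add0r addrC mdistDr.
Qed.

(** If [a] moves [x] from the complement into [A], then [- a] moves [x + a] out of [A]. *)
Lemma shift_continuousC (A : set B) : measurable A ->
  shift_continuous A -> shift_continuous (~` A).
Proof.
move=> mA cA e e0; have [d d0 dP] := cA e e0; exists d => // a ad.
have /dP : (mdist (- a) 0 < d)%R.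
  by rewrite -[X in mdist _ X]oppr0 mdistNN.
rewrite -(haar_preimageDr hmu a (measurable_shift_out _ mA)).
apply: le_lt_trans; apply: le_measure; rewrite ?inE.
- by apply: measurable_shift_out; exact: measurableC.
- by apply: measurable_shift; exact: measurable_shift_out.
- by move=> x [nAx /contrapT Axa]; split => //=; rewrite addrK.
Qed.

Lemma shift_continuousU (A A' : set B) : measurable A -> measurable A' ->
  shift_continuous A -> shift_continuous A' -> shift_continuous (A `|` A').
Proof.
move=> mA mA' cA cA' e e0; have e20 : (0 < e / 2)%R by rewrite divr_gt0.
have [d d0 dP] := cA _ e20; have [d' d'0 d'P] := cA' _ e20.
exists (Num.min d d'); first by rewrite lt_min d0.
move=> a; rewrite lt_min => /andP[/dP h /d'P h'].
rewrite [e]splitr EFinD; apply: le_lt_trans (lteD h h').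
rewrite (le_trans _ (measureU2 _ _ _))//; [|exact: measurable_shift_out..].
apply: le_measure; rewrite ?inE.
- by apply: measurable_shift_out; exact: measurableU.
- by apply: measurableU; exact: measurable_shift_out.
- by move=> x [[Ax|Ax] /not_orP[? ?]]; [left|right].
Qed.

(** A finite union [V n] exhausts the whole union up to measure [e / 2]. A point moved out of the
    whole union is either missed by [V n] or moved out of [V n]. *)
Lemma shift_continuous_bigcup (A : (set B)^nat) :
  (forall n, measurable (A n)) -> (forall n, shift_continuous (A n)) ->
  shift_continuous (\bigcup_n A n).
Proof.
move=> mA cA e e0; have e20 : (0 < e / 2)%R by rewrite divr_gt0.
pose V n : set B := \bigcup_(i < n) A i.
have mV n : measurable (V n) by apply: bigcup_measurable.
have cV n : shift_continuous (V n).
  elim: n => [|n IH].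
    rewrite /V II0 bigcup_set0 => r r0; exists 1%R => // a _.
    suff -> : shift_out set0 a = set0 by rewrite measure0 lte_fin.
    by apply/seteqP; split=> // x [].
  rewrite /V IIS bigcup_setU bigcup_set1.
  exact: (shift_continuousU (mV n) (mA n) IH (cA n)).
pose F n : set B := (\bigcup_i A i) `\` V n.
have mbA : measurable (\bigcup_i A i) by exact: bigcupT_measurable.
have mF n : measurable (F n) by exact: measurableD.
have [|||n Fn] := @small_measure_bigcap _ B R mu F (e / 2) mF.
- move=> p q pq; apply/subsetPset; apply: setDS.
  by apply: bigcup_subset => i /= ip; exact: leq_trans ip pq.
- rewrite (_ : \bigcap_n _ = set0) ?measure0//.
  apply/seteqP; split=> // x FI; have [[i _ Ai] _] := FI 0%N I.
  by have [_] := FI i.+1 I; apply; exists i => /=.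
- exact: e20.
have [d d0 dP] := cV n _ e20; exists d => // a /dP h.
rewrite [e]splitr EFinD; apply: le_lt_trans (lteD Fn h).
rewrite (le_trans _ (measureU2 _ _ _))//; last exact: measurable_shift_out.
apply: le_measure; rewrite ?inE.
- exact: measurable_shift_out.
- by apply: measurableU => //; exact: measurable_shift_out.
- move=> x [Ax Axa]; have [Vx|Vx] := pselect (V n x); last by left.
  right; split => //; apply: contra_not Axa => -[i _ ?]; by exists i.
Qed.

(** The measurable sets with this continuity form a sigma-algebra containing the open sets. *)
Lemma measurable_shift_continuous (A : set B) : measurable A -> shift_continuous A.
Proof.
move=> mA.
suff [] : [set A : set B | measurable A /\ shift_continuous A] A by [].
apply: smallest_sub mA; last first.
  by move=> U oU; split; [exact: borel_open|exact: shift_continuous_open].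
split.
- split; first exact: measurable0.
  by apply: shift_continuous_open; exact: open0.
- move=> X [mX cX]; rewrite setTD; split; first exact: measurableC.
  exact: shift_continuousC.
- move=> F FP; split; first by apply: bigcupT_measurable => n; have [] := FP n.
  by apply: shift_continuous_bigcup => n; have [] := FP n.
Qed.

(** A point moved out of [A] by [a + b] leaves either in the first step, by [a], or in the second,
    by [b]. *)
Lemma shift_out0 (A : set B) (a b : T) : measurable A ->
  mu (shift_out A a) = 0 -> mu (shift_out A b) = 0 -> mu (shift_out A (a + b)%R) = 0.
Proof.
move=> mA Aa Ab; apply/eqP; rewrite eq_le measure_ge0 andbT.
have mab := measurable_shift a (measurable_shift_out b mA).
apply: (@le_trans _ _ (mu (shift_out A a `|` [set x | shift_out A b (x + a)%R]))).
  apply: le_measure; rewrite ?inE; first exact: measurable_shift_out.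
    by apply: measurableU => //; exact: measurable_shift_out.
  move=> x [Ax nAx]; have [Axa|nAxa] := pselect (A (x + a)%R); last by left.
  by right; split=> //; rewrite -addrA.
rewrite (le_trans (measureU2 _ _ _))//; first exact: measurable_shift_out.
have := haar_preimageDr hmu a (measurable_shift_out b mA); rewrite Ab => Aab.
suff : mu (shift_out A a) + mu ((fun x : T => x + a)%R @^-1` shift_out A b) <= 0 by [].
by rewrite Aa Aab adde0.
Qed.

(** Since [A] is its own preimage, [shift_out A a] is the preimage of [shift_out A (F a)], and [F]
    preserves the measure. *)
Lemma shift_out_endo (F : T -> T) (A : set B) (a : T) :
  {morph F : x y / (x + y)%R} -> continuous F -> (forall y, exists x, F x = y) ->
  measurable A -> F @^-1` A = A -> mu (shift_out A (F a)) = mu (shift_out A a).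
Proof.
move=> FD cF sF mA FA.
rewrite -(haar_invariant_endo hmu FD cF sF (measurable_shift_out (F a) mA)).
by congr (mu _); rewrite /shift_out -[in RHS]FA; apply/seteqP; split=> x /=; rewrite FD.
Qed.

(** The measure of [shift_out A b] is constant along the orbit of [b]. It can be evaluated far
    forward for the stable part [s] and far back for the unstable part [u]; both times the
    translation is near 0, so the measure is 0. *)
Lemma invariant_trivial (F : T -> T) (A : set B) :
  {morph F : x y / (x + y)%R} -> continuous F -> (forall y, exists x, F x = y) ->
  (forall a, exists s u, [/\ a = (s + u)%R,
     forall d : R, (0 < d)%R -> exists n, (mdist (iter n F s) 0 < d)%R &
     forall d : R, (0 < d)%R -> exists n b, iter n F b = u /\ (mdist b 0 < d)%R]) ->
  measurable A -> F @^-1` A = A -> mu A = 0 \/ mu A = 1.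
Proof.
move=> FD cF sF Fsu mA FA; apply: haar_zero_one => // a.
have itF n b : mu (shift_out A (iter n F b)) = mu (shift_out A b).
  by elim: n => //= n <-; exact: shift_out_endo.
have small b : (forall e : R, (0 < e)%R -> mu (shift_out A b) < e%:E) ->
    mu (shift_out A b) = 0.
  move=> h; apply/eqP; rewrite eq_le measure_ge0 andbT.
  by apply/lee_addgt0Pr => e e0; rewrite add0e ltW// h.
have cA := measurable_shift_continuous mA.
have [s [u [-> hs hu]]] := Fsu a; apply: shift_out0 => //; apply: small => e /cA.
  by move=> [d /hs[n sn] dP]; rewrite -(itF n); exact: dP.
by move=> [d /hu[n [b [<- bd]]] dP]; rewrite itF; exact: dP.
Qed.

End translation_continuity.

(** * Splitting of a Pisot matrix *)

(** Convergence to 0 with only the upper bound recorded, as it is used for sequences of norms. *)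
Definition vanishes {R : realType} (x : nat -> R) :=
  forall d, 0 < d -> exists N, forall n, (N <= n)%N -> x n < d.

Lemma vanishes_geometric {R : realType} (r c : R) :
  0 <= r -> r < 1 -> vanishes (fun n => r ^+ n * c).
Proof.
move=> r0 r1 d d0.
have c10 : 0 < `|c| + 1 by rewrite ltr_wpDl.
have /cvgrPdist_lt/(_ (d / (`|c| + 1)))[|N _ NP] : r ^+ n @[n --> \oo] --> 0.
- by apply: cvg_expr; rewrite ger0_norm.
- by rewrite divr_gt0.
exists N => n /NP /=; rewrite sub0r normrN => rn.
apply: le_lt_trans (ler_norm _) _; rewrite normrM.
rewrite ltr_pdivlMr// in rn; apply: le_lt_trans rn.
by rewrite ler_wpM2l// lerDl.
Qed.

Lemma vanishes_contraction {R : realType} (x e : nat -> R) (r : R) :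
  0 <= r -> r < 1 -> (forall n, x n.+1 <= r * x n + e n) ->
  vanishes e -> vanishes x.
Proof.
move=> r0 r1 xe e0 d d0.
have r10 : 0 < 1 - r by rewrite subr_gt0.
have d20 : 0 < d / 2 by rewrite divr_gt0.
have [N NP] := e0 _ (mulr_gt0 d20 r10).
(* From [N] on the error is below [d / 2 * (1 - r)], and [d / 2] is the fixed point of
   [t |-> r * t + d / 2 * (1 - r)]. *)
have le k : x (N + k)%N <= r ^+ k * x N + d / 2.
  elim: k => [|k IH]; first by rewrite addn0 expr0 mul1r lerDl ltW.
  rewrite addnS exprS -mulrA; apply: le_trans (xe _) _.
  have := NP _ (leq_addr k N); have := ler_wpM2l r0 IH.
  rewrite mulrDr mulrBr mulr1; lra.
have [K KP] := vanishes_geometric (x N) r0 r1 d20.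
exists (N + K)%N => n NKn.
have := le (n - N)%N; rewrite subnKC ?(leq_trans (leq_addr _ _) NKn)//.
have := KP (n - N)%N; rewrite leq_subRL ?(leq_trans (leq_addr _ _) NKn)//.
by move=> /(_ NKn); lra.
Qed.

Lemma normc_real {R : rcfType} (t : R) : Normc.normc t%:C%C = `|t|.
Proof. by rewrite /Normc.normc /= expr0n/= addr0 sqrtr_sqr. Qed.

(** Plays the part of a Jordan form by removing one root [z] at a time: with [w' = (A - z) w], each
    coordinate satisfies [A^(k+1) w = z A^k w + A^k w'], a contraction of ratio [|z|] with an error
    that vanishes by induction. *)
Lemma vanishes_horner_mx {R : realType} {n : nat} (A : 'M[R[i]]_n.+1)
    (zs : seq R[i]) (w : 'cV[R[i]]_n.+1) :
  (forall z, z \in zs -> Normc.normc z < 1) ->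
  (forall i, vanishes (fun k => Normc.normc
     ((A ^+ k *m (horner_mx A (\prod_(z <- zs) ('X - z%:P)) *m w)) i 0))) ->
  forall i, vanishes (fun k => Normc.normc ((A ^+ k *m w) i 0)).
Proof.
elim: zs w => [|z zs IH] w zs1.
  by rewrite big_nil rmorph1 mul1mx.
rewrite big_cons mulrC rmorphM/= => h.
have {h} /IH : forall i, vanishes (fun k => Normc.normc ((A ^+ k *m
    (horner_mx A (\prod_(z <- zs) ('X - z%:P)) *m
       (horner_mx A ('X - z%:P) *m w))) i 0)).
  by move=> i; have := h i; rewrite -[(_ * _) *m w]mulmxA.
move=> /(_ _) h i.
have {}h := h (fun y yz => zs1 y (@mem_behead _ (z :: zs) y yz)) i.
apply: (@vanishes_contraction _ _ _ (Normc.normc z)) h.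
- by case: (z) => a b; exact: sqrtr_ge0.
- by apply: zs1; rewrite mem_head.
move=> k; rewrite -Normc.normcM.
have -> : (A ^+ k.+1 *m w) i 0 =
    z * (A ^+ k *m w) i 0 + (A ^+ k *m (horner_mx A ('X - z%:P) *m w)) i 0.
  rewrite rmorphB/= horner_mx_X horner_mx_C mulmxBl mulmxBr mul_scalar_mx.
  rewrite -scalemxAr exprSr -[(_ * A) *m w]mulmxA !mxE; ring.
exact: le_normcD.
Qed.

(** Over the rationals an irreducible polynomial is coprime to its nonzero derivative, whose degree
    is smaller. Coprimality survives the passage to the reals, so the root is simple. *)
Lemma pisot_beta_simple (P : {poly int}) {R : realType} (b : R) :
  irreducible_poly (map_poly intr P : {poly rat}) -> root (map_poly intr P) b ->
  ((map_poly intr P)^`()).[b] != 0.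
Proof.
set p := map_poly intr P : {poly rat} => irr.
have -> : map_poly intr P = map_poly ratr p :> {poly R}.
  by rewrite -map_poly_comp; apply: eq_map_poly => z /=; rewrite ratr_int.
have p'0 : p^`() != 0.
  rewrite -size_poly_eq0 (size_deriv p) -lt0n.
  by case: irr => + _; case: (size p) => [|[]].
move=> pb; rewrite deriv_map.
apply: (coprimep_root (p := map_poly ratr p)) => //; rewrite coprimep_map.
apply: contraT; rewrite irreducible_poly_coprime// negbK => /(dvdp_leq p'0).
by rewrite leqNgt lt_size_deriv//; apply: contraNneq p'0 => ->; rewrite deriv0.
Qed.

Lemma horner_mx_eigenvector {K : fieldType} {n : nat} (A : 'M[K]_n.+1)
    (b : K) (w : 'cV[K]_n.+1) (q : {poly K}) :
  A *m w = b *: w -> horner_mx A q *m w = q.[b] *: w.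
Proof.
move=> Aw; elim/poly_ind: q => [|q c IH].
  by rewrite rmorph0 mul0mx horner0 scale0r.
rewrite rmorphD rmorphM/= horner_mx_X horner_mx_C mulmxDl -mulmxA Aw -scalemxAr IH.
by rewrite mul_scalar_mx hornerMXaddC scalerDl scalerA mulrC.
Qed.

(** Write the characteristic polynomial as [q * (X - b)] with [q.[b] != 0]. By Cayley-Hamilton the
    range of [q(A)] consists of solutions of [A w = b w], so [u = q.[b]^-1 q(A) v] is the expanding
    part. The rest [v - u] is killed by [q(A)], and the complex roots of [q] lie in the open unit
    disc. *)
Lemma pisot_splitting_mx {R : realType} {n : nat} (M : 'M[int]_n.+1)
    (v : 'cV[R]_n.+1) : @pisot_char_poly R n.+1 M ->
  exists b s u, [/\ v = s + u, 1 < b, map_mx intr M *m u = b *: u &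
    forall i, vanishes (fun k => `|(map_mx intr M ^+ k *m s) i 0|)].
Proof.
move=> [irr [b [b1 pb roots]]].
set A := map_mx intr M : 'M[R]_n.+1.
set p := map_poly intr (char_poly M) in pb roots *.
have pA : p = char_poly A by rewrite /p map_char_poly.
have [q pq] := factor_theorem _ _ pb.
have qb : q.[b] != 0.
  have := pisot_beta_simple irr pb; rewrite -/p pq derivM derivXsubC mulr1.
  by rewrite hornerD hornerM hornerXsubC subrr mulr0 add0r.
have eig w : A *m (horner_mx A q *m w) = b *: (horner_mx A q *m w).
  have := Cayley_Hamilton A; rewrite -pA pq rmorphM/= rmorphB/= horner_mx_X.
  rewrite horner_mx_C mulrBr => /eqP; rewrite subr_eq0 => /eqP qAb.
  have cqA : A *m horner_mx A q = horner_mx A q *m A.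
    by have := comm_mx_horner q (comm_mx_refl A); rewrite /comm_mx => ->.
  by rewrite mulmxA cqA [_ *m A]qAb -mulmxA mul_scalar_mx -scalemxAr.
pose u := q.[b]^-1 *: (horner_mx A q *m v).
have Au : A *m u = b *: u by rewrite /u -scalemxAr eig !scalerA mulrC.
exists b, (v - u), u; split => //; first by rewrite subrK.
have qs : horner_mx A q *m (v - u) = 0.
  by rewrite mulmxBr (horner_mx_eigenvector q Au) /u scalerA mulfV// scale1r subrr.
pose c := real_complex R.
have [zs qzs] := closed_field_poly_normal (map_poly c q).
have q0 : q != 0 by apply: contra_neq qb => ->; rewrite horner0.
have lq0 : lead_coef (map_poly c q) != 0 by rewrite lead_coef_eq0 map_poly_eq0.
have zs1 z : z \in zs -> Normc.normc z < 1.
  move=> zzs; have qz : root (map_poly c q) z.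
    by rewrite qzs rootZ// root_prod_XsubC.
  have pz : root (map_poly intr (char_poly M)) z.
    suff -> : map_poly intr (char_poly M) = map_poly c p.
      by rewrite pq rmorphM/= rootM qz.
    by rewrite -map_poly_comp; apply: eq_map_poly => k /=; rewrite /c rmorph_int.
  rewrite -ltcR; apply: roots pz _; apply: contraTneq qz => ->.
  by rewrite /root horner_map fmorph_eq0.
move=> i.
have mapk k : (map_mx c A ^+ k *m map_mx c (v - u)) i 0 = c ((A ^+ k *m (v - u)) i 0).
  by rewrite -(rmorphXn (map_mx c)) -map_mxM mxE.
suff hv : vanishes (fun k => Normc.normc ((map_mx c A ^+ k *m map_mx c (v - u)) i 0)).
  by move=> d /hv[N NP]; exists N => k /NP; rewrite mapk normc_real.
(* After all factors of [q] have been applied the vector is 0, so the remaining sequence is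
   identically 0. *)
apply: (vanishes_horner_mx zs1) => j d d0; exists 0%N => k _.
suff -> : horner_mx (map_mx c A) (\prod_(z <- zs) ('X - z%:P)) *m map_mx c (v - u) = 0.
  by rewrite mulmx0 mxE Normc.normc0.
apply: (scalerI lq0); rewrite scaler0 scalemxAl.
have <- : map_mx c (horner_mx A q) =
    lead_coef (map_poly c q) *: horner_mx (map_mx c A) (\prod_(z <- zs) ('X - z%:P)).
  by rewrite map_horner_mx {1}qzs linearZ.
by rewrite -map_mxM qs map_mx0.
Qed.

(** * Toral automorphisms *)

(** If [l i] is an integer nearest to [t i], the sum of the [k i * l i] is an integer to compare
    with, because the [k i] are integers. *)
Lemma dZ_sum_intr {R : realType} {I : finType} (k : I -> int) (t : I -> R) :
  dZ (\sum_i (k i)%:~R * t i) <= \sum_i `|(k i)%:~R| * dZ (t i).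
Proof.
pose l i := projT1 (cid (dZ_ex (t i))).
have lE i : dZ (t i) = `|t i - (l i)%:~R| by rewrite /l; case: cid.
apply: le_trans (dZ_le _ (\sum_i k i * l i)) _.
rewrite rmorph_sum -sumrB; apply: le_trans (ler_norm_sum _ _ _) _.
by apply: ler_sum => i _; rewrite lE rmorphM/= -mulrBr normrM.
Qed.

Section toral_map_theory.
Context {R : realType} {m : nat}.
Local Notation T := (torus R m).
Implicit Types (M : 'M[int]_m) (F : T -> T) (x y : T).

Lemma toral_map_tproj M v : toral_map M (tproj v) = tproj (map_mx intr M *m v) :> T.
Proof. exact: toral_mapE. Qed.

Lemma toral_mapD M : {morph (toral_map M : T -> T) : x y / x + y}.
Proof.
move=> x y; have [u ->] := tproj_surj x; have [v ->] := tproj_surj y.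
by rewrite -tprojD !toral_map_tproj mulmxDr tprojD.
Qed.

Lemma toral_map_lipschitz M : exists2 C : R, 0 < C &
  forall x y, mdist (toral_map M x) (toral_map M y) <= C * mdist x y.
Proof.
pose S : R := \sum_i \sum_j `|(M i j)%:~R|.
have S0 : 0 <= S by apply: sumr_ge0 => i _; exact: sumr_ge0.
(* The added 1 keeps the Lipschitz constant positive even for a zero matrix. *)
exists (1 + S); first lra.
move=> x y; have [u ->] := tproj_surj x; have [v ->] := tproj_surj y.
rewrite !toral_map_tproj [leLHS]mdist_tproj; apply: bigmax_le => [|i _].
  by rewrite mulr_ge0 ?mdist_ge0// addr_ge0.
rewrite !mxE -sumrB (eq_bigr (fun j => (M i j)%:~R * (u j 0 - v j 0))); last first.
  by move=> j _; rewrite !mxE mulrBr.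
apply: le_trans (dZ_sum_intr _ _) _.
apply: (@le_trans _ _ (\sum_j `|(M i j)%:~R| * mdist (tproj u) (tproj v))).
  apply: ler_sum => j _; rewrite ler_wpM2l// mdist_tproj.
  exact: (le_bigmax _ (fun j => dZ (u j 0 - v j 0))).
rewrite -mulr_suml ler_wpM2r ?mdist_ge0//.
apply: (@le_trans _ _ S); last by rewrite lerDr.
by rewrite /S [leRHS](bigD1 i)//= lerDl sumr_ge0// => ? _; exact: sumr_ge0.
Qed.

Lemma toral_map_continuous M : continuous (toral_map M : T -> T).
Proof.
have [C C0 lip] := toral_map_lipschitz M.
apply/continuousP => U /open_torusP oU; apply/open_torusP => x /= /oU[e e0 eU].
exists (e / C); first by rewrite divr_gt0.
move=> y; rewrite ballEmdist/= ltr_pdivlMr// => xy; apply: eU.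
by rewrite ballEmdist/=; apply: le_lt_trans xy; rewrite mulrC.
Qed.

(* Only even iterates are recorded, so that the notion does not distinguish
   between F and -F. *)
Definition even_splitting F := forall a, exists s u, [/\ a = s + u,
  forall d : R, 0 < d -> exists n, mdist (iter n.*2 F s) 0 < d &
  forall d : R, 0 < d -> exists n b, iter n.*2 F b = u /\ mdist b 0 < d].

(** An additive map is odd, so [F] and its opposite have the same even iterates. *)
Lemma even_splitting_opp F : {morph F : x y / x + y} ->
  even_splitting (opp_map F) -> even_splitting F.
Proof.
move=> FD; have F0 : F 0 = 0 by apply: (addrI (F 0)); rewrite -FD !addr0.
have FN x : F (- x) = - F x by apply/eqP; rewrite -addr_eq0 -FD addNr F0.
have itE n x : iter n.*2 (opp_map F) x = iter n.*2 F x.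
  by elim: n => //= n ->; rewrite /opp_map FN opprK.
move=> sF a; have [s [u [-> hs hu]]] := sF a; exists s, u; split=> // d d0.
  by have [n] := hs d d0; rewrite itE; exists n.
by have [n [b []]] := hu d d0; rewrite itE; exists n, b.
Qed.

End toral_map_theory.

Lemma iter_toral_map {R : realType} {n : nat} (M : 'M[int]_n.+1) k v :
  iter k (toral_map M) (tproj v) = tproj (map_mx intr M ^+ k *m v) :> torus R n.+1.
Proof.
elim: k => [|k IH]; first by rewrite expr0 mul1mx.
by rewrite iterS IH toral_map_tproj exprS mulmxA.
Qed.

Lemma pisot_even_splitting {R : realType} {n : nat} (F : torus R n.+1 -> torus R n.+1) :
  pisot_automorphism F -> even_splitting F.
Proof.
move=> [M [_ -> pM]] a; have [v ->] := tproj_surj a.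
have [b [s [u [-> b1 Mu hs]]]] := pisot_splitting_mx v pM.
have b0 : 0 < b by rewrite (lt_trans _ b1).
exists (tproj s), (tproj u); split; first by rewrite tprojD.
- move=> d d0.
  pose N i := projT1 (cid (hs i d d0)).
  (* Past the largest of the finitely many thresholds every coordinate is small, and doubling the
     exponent only increases it. *)
  exists (\max_i N i)%N; rewrite iter_toral_map -tproj0 mdist_tproj.
  apply: bigmax_lt => // i _.
  rewrite (le_lt_trans (dZ_le _ 0))// subr0 [X in _ - X]mxE subr0.
  rewrite /N; have := leq_bigmax i (F := N); rewrite /N.
  case: cid => /= K KP Ki; apply: KP; apply: leq_trans Ki _.
  by rewrite -addnn leq_addr.
- move=> d d0.
  have [|||N NP] := @vanishes_geometric R b^-1 `|u| _ _ d.
  + by rewrite invr_ge0 ltW.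
  + by rewrite invf_lt1.
  + exact: d0.
  (* The vector [u] is expanded by [b], so [b^(-2N) u] reaches it after [2N] steps and is small for
     large [N]. *)
  exists N, (tproj ((b^-1) ^+ N.*2 *: u)); split.
    rewrite iter_toral_map; congr tproj.
    have Mk k : map_mx intr M ^+ k *m u = b ^+ k *: u.
      elim: k => [|k IH]; first by rewrite !expr0 mul1mx scale1r.
      by rewrite exprS -mulmxA IH -scalemxAr Mu scalerA exprSr.
    by rewrite -scalemxAr Mk scalerA -exprMn mulVf ?gt_eqF// expr1n scale1r.
  rewrite -tproj0; apply: le_lt_trans (mdist_tproj_le _ _) _.
  rewrite subr0 mx_normZ ger0_norm ?exprn_ge0 ?invr_ge0 ?ltW//.
  by apply: NP; rewrite -addnn leq_addr.
Qed.

(** An [F]-invariant set is also invariant under the inverse [G], so a splitting for either map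
    suffices; a sign is absorbed by [even_splitting_opp]. *)
Lemma generalized_pisot_ergodic {R : realType} {n : nat}
    (mu : probability (borel (torus R n.+1)) R) (F : torus R n.+1 -> torus R n.+1) :
  haar_measure mu -> generalized_pisot F -> ergodic mu F.
Proof.
move=> hmu [[M _ FM] [G [FG GF pF]]] A mA FA.
have FD : {morph F : x y / x + y} by rewrite FM; exact: toral_mapD.
have cF : continuous F by rewrite FM; exact: toral_map_continuous.
have GD : {morph G : x y / x + y}.
  by move=> x y; rewrite -{1}(GF x) -{1}(GF y) -FD FG.
have GA : G @^-1` A = A by rewrite -[in LHS]FA; apply/funext => x /=; rewrite GF.
have trivial_of (H : torus R n.+1 -> torus R n.+1) : {morph H : x y / x + y} ->
    continuous H -> (forall y, exists x, H x = y) -> H @^-1` A = A ->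
    even_splitting H -> mu A = 0%E \/ mu A = 1%E.
  move=> HD cH sH HA spl; apply: (invariant_trivial hmu HD cH sH _ mA HA) => a.
  have [s [u [-> hs hu]]] := spl a; exists s, u; split=> // d d0.
    by have [k] := hs d d0; exists k.*2.
  by have [k [b]] := hu d d0; exists k.*2, b.
have cG : pisot_automorphism G \/ pisot_automorphism (opp_map G) -> continuous G.
  move=> [[N [_ -> _]]|[N [_ GN _]]]; first exact: toral_map_continuous.
  have -> : G = (fun x => - x) \o toral_map N.
    by apply/funext => x; rewrite -GN /= /opp_map opprK.
  move=> x; apply: continuous_comp; first exact: toral_map_continuous.
  exact: oppr_torus_continuous.
have sF y : exists x, F x = y by exists (G y).
have sG y : exists x, G x = y by exists (F y).
case: pF => pF.
- by apply: (trivial_of F) => //; exact: pisot_even_splitting.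
- apply: (trivial_of F) => //; apply: even_splitting_opp => //.
  exact: pisot_even_splitting.
- by apply: (trivial_of G) => //; [apply: cG; left|exact: pisot_even_splitting].
- apply: (trivial_of G) => //; first by apply: cG; right.
  by apply: even_splitting_opp => //; exact: pisot_even_splitting.
Qed.

(** * Slabs and Property S *)

Lemma dZ_add_int {R : realType} (t : R) (k : int) : dZ (t + k%:~R) = dZ t.
Proof.
have le (s : R) (l : int) : dZ (s + l%:~R) <= dZ s.
  by rewrite (le_trans (dZD _ _))// (dZ_int (intr_int _ l)) addr0.
by apply/eqP; rewrite eq_le le -{1}(addrK (k%:~R) t) -rmorphN le.
Qed.

Section slabs.
Context {R : realType} {m : nat}.
Local Notation T := (torus R m).
Local Notation B := (borel T).

(** The set is a union of segments from [p], whose connected images all contain [tproj p]. *)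
Lemma star_shaped_connected (p : 'cV[R]_m) (D : set 'cV[R]_m) :
  (forall v (t : R), D v -> 0 <= t <= 1 -> D (p + t *: (v - p))) ->
  connected (tproj @` D : set T).
Proof.
move=> starD.
pose seg v : set T := (fun t : R => tproj (p + t *: (v - p))) @` `[0, 1]%classic.
have -> : tproj @` D = \bigcup_(v in D) seg v.
  apply/seteqP; split => [_ [v Dv <-]|_ [v Dv] [t /= + <-]]; last first.
    by rewrite in_itv/= => t01; exists (p + t *: (v - p)) => //; exact: starD.
  exists v => //; exists 1; first by rewrite /= in_itv/= ler01 lexx.
  by rewrite scale1r addrC subrK.
apply: bigcup_connected.
  by exists (tproj p) => v _; exists 0;
    [rewrite /= in_itv/= lexx ler01|rewrite scale0r addr0].
move=> v _; apply: connected_continuous_connected; first exact: segment_connected.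
apply: continuous_subspaceT => t.
apply: continuous_comp; last exact: tproj_continuous.
by apply: cvgD; [exact: cvg_cst|apply: cvgZr_tmp; exact: cvg_id].
Qed.

(** Written as the image of a strip, so that connectedness comes from star-shapedness; [slab_tproj]
    gives the description modulo integers. *)
Definition slab (i : 'I_m) (c r : R) : set T :=
  tproj @` [set v : 'cV[R]_m | `|v i 0 - c| < r].

Lemma slab_tproj i c r v : slab i c r (tproj v) <-> dZ (v i 0 - c) < r.
Proof.
split=> [[w /= wr /tproj_eqP/(_ i)/intrP[k wv]]|].
  have -> : v i 0 - c = (w i 0 - c) + (- k)%:~R by rewrite rmorphN/= -wv; ring.
  by rewrite dZ_add_int (le_lt_trans (dZ_le _ 0))// subr0.
have [k ->] := dZ_ex (v i 0 - c) => kr.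
exists (\col_j (v j 0 - k%:~R)) => /=; first by rewrite mxE addrAC.
apply/tproj_eqP => j; rewrite mxE addrAC subrr add0r rpredN.
exact: intr_int.
Qed.

Lemma slab_connected i c r : connected (slab i c r).
Proof.
apply: (star_shaped_connected (p := \col_j c)) => v t /= vc /andP[t0 t1].
rewrite !mxE; have -> : c + t * (v i 0 - c) - c = t * (v i 0 - c) by ring.
by rewrite normrM ger0_norm//; apply: le_lt_trans vc; rewrite ler_piMl.
Qed.

Lemma slab_open i c r : open (slab i c r).
Proof.
apply/open_torusP => x; have [v ->] := tproj_surj x => /slab_tproj vr.
exists (r - dZ (v i 0 - c)); first by rewrite subr_gt0.
move=> y; have [w ->] := tproj_surj y; rewrite ballEmdist/= => vw.
apply/slab_tproj.
have -> : w i 0 - c = (v i 0 - c) - (v i 0 - w i 0) by ring.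
apply: le_lt_trans (dZD _ _) _; rewrite dZN -ltrBrDl; apply: le_lt_trans vw.
rewrite mdist_tproj; exact: (le_bigmax _ (fun j => dZ (v j 0 - w j 0))).
Qed.

Lemma ball_torus_connected (x : T) (r : R) : connected (ball x r).
Proof.
have [p ->] := tproj_surj x; have [r0|r0] := ltP 0 r; last first.
  suff -> : ball (tproj p : T) r = set0 by exact: connected0.
  apply/seteqP; split=> // y; rewrite ballEmdist/= => /lt_le_trans/(_ r0).
  by rewrite ltNge mdist_ge0.
(* For every radius the ball is the image of a ball of [R^m]: subtracting nearest integers brings a
   representative close to [p]. *)
suff -> : ball (tproj p : T) r = tproj @` [set v : 'cV[R]_m | `|v - p| < r].
  apply: (star_shaped_connected (p := p)) => v t /= vp /andP[t0 t1].
  rewrite addrC addKr mx_normZ ger0_norm//; apply: le_lt_trans vp.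
  by rewrite ler_piMl.
apply/seteqP; split => [y|_ [v /= vp <-]]; last first.
  by rewrite ballEmdist/= mdist_sym; apply: le_lt_trans vp; exact: mdist_tproj_le.
have [w ->] := tproj_surj y; rewrite ballEmdist/= mdist_sym mdist_tproj => wp.
pose l i := projT1 (cid (dZ_ex (w i 0 - p i 0))).
exists (\col_i (w i 0 - (l i)%:~R)) => /=.
  rewrite [ltLHS]mx_normrE; apply: bigmax_lt => // -[i j] _ /=.
  rewrite (ord1 j) !mxE addrAC /l; case: cid => k /= <-.
  apply: le_lt_trans wp; exact: (le_bigmax _ (fun i => dZ (w i 0 - p i 0))).
apply/tproj_eqP => j; rewrite mxE addrAC subrr add0r rpredN.
exact: intr_int.
Qed.

Variable mu : probability (borel (torus R m)) R.
Hypothesis hmu : haar_measure mu.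

Lemma slab_shift i c c' r :
  (fun x : T => x + tproj (\col_j (c' - c))) @^-1` slab i c' r = slab i c r.
Proof.
apply/seteqP; split => x; have [v ->] := tproj_surj x; rewrite /= -tprojD.
  by move=> /slab_tproj h; apply/slab_tproj; move: h; rewrite !mxE;
     congr (dZ _ < _); ring.
by move=> /slab_tproj h; apply/slab_tproj; move: h; rewrite !mxE;
   congr (dZ _ < _); ring.
Qed.

Lemma measure_slab i c c' r : mu (slab i c r) = mu (slab i c' r).
Proof.
rewrite -(slab_shift i c c' r); apply: haar_preimageDr => //.
by apply: borel_open; exact: slab_open.
Qed.

(** The [k] translates by multiples of [1/k] have equal measure and thickness [2r = 1/k]. They are
    disjoint in a space of measure 1. *)
Lemma measure_slab_le i c k : (0 < k)%N ->
  (mu (slab i c (k.*2%:R^-1)) <= (k%:R^-1)%:E)%E.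
Proof.
move=> k0; set r := k.*2%:R^-1.
have kR : 0 < k%:R :> R by rewrite ltr0n.
have r2 : r + r = k%:R^-1.
  by rewrite /r -addnn natrD; field; rewrite !gt_eqF// addr_gt0.
pose A (j : nat) : set B := slab i (c + j%:R / k%:R) r.
have mA j : measurable (A j) by apply: borel_open; exact: slab_open.
have tA : trivIset `I_k A.
  move=> j j' /= jk j'k [x [Ax A'x]]; apply: contrapT => jj'.
  move: Ax A'x; have [v ->] := tproj_surj x => /slab_tproj h /slab_tproj h'.
  (* A common point puts [(j - j') / k] within less than [1/k] of an integer [l], so
     [j - j' = l * k]; as both indices are below [k], this forces [l = 0]. *)
  have : dZ ((j%:R - j'%:R) / k%:R : R) < k%:R^-1.
    have -> : (j%:R - j'%:R) / k%:R =
        (v i 0 - (c + j'%:R / k%:R)) + - (v i 0 - (c + j%:R / k%:R)) by ring.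
    by rewrite -[ltRHS]r2; apply: le_lt_trans (dZD _ _) _; rewrite dZN;
       exact: (ltrD h' h).
  have [l ->] := dZ_ex ((j%:R - j'%:R) / k%:R : R).
  have -> : (j%:R - j'%:R) / k%:R - l%:~R = (j%:Z - j'%:Z - l * k%:Z)%:~R / k%:R :> R.
    by rewrite !rmorphB rmorphM/=; field; rewrite gt_eqF.
  rewrite normrM [X in _ * X]gtr0_norm ?invr_gt0// -[ltRHS]mul1r ltr_pM2r ?invr_gt0//.
  rewrite -intr_norm ltrz1 => h0.
  have jl : j%:Z - j'%:Z = l * k%:Z by lia.
  have [l0|[l0|l0]] : l = 0 \/ 1 <= l \/ l <= -1 by lia.
  - by move: jl; rewrite l0 mul0r; lia.
  - by have : k%:Z <= l * k%:Z by [rewrite ler_peMl]; lia.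
  - by have : k%:Z <= - l * k%:Z by [rewrite ler_peMl//; lia]; rewrite mulNr; lia.
have mU : measurable (\big[setU/set0]_(j < k) A j) by apply: bigsetU_measurable.
have := probability_le1 mu mU.
rewrite (measure_semi_additive_ord_I mu (F := A))//.
have Ac (j : 'I_k) : true -> mu (A j) = mu (slab i c r).
  by move=> _; exact: measure_slab.
rewrite (eq_bigr _ Ac) -(fineK (fin_num_measure mu _ (borel_open (@slab_open i c r)))).
rewrite sumEFin sumr_const card_ord !lee_fin => h.
by rewrite -[leRHS]div1r ler_pdivlMr// mulr_natr.
Qed.

(** Countably many rational translates of the slab cover the torus. They are indexed through
    [unpickle], with the empty set at codes of no rational. *)
Lemma measure_slab_gt0 i c r : 0 < r -> mu (slab i c r) != 0%E.
Proof.
move=> r0; apply/eqP => s0.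
pose F (n : nat) : set B :=
  if unpickle n is Some q then slab i (c + ratr (q : rat)) r else set0.
have : mu.-negligible (\bigcup_n F n).
  apply: negligible_bigcup => n; rewrite /F; case: unpickle => [q|];
    last exact: negligible_set0.
  apply/negligibleP; first by apply: borel_open; exact: slab_open.
  by rewrite -s0; exact: measure_slab.
have -> : \bigcup_n F n = setT.
  apply/seteqP; split=> // x _; have [v ->] := tproj_surj x.
  have [q qr] := rat_approx (v i 0 - c) r0.
  exists (pickle q); first exact: I.
  rewrite /F pickleK; apply/slab_tproj.
  rewrite opprD addrA (le_lt_trans (dZ_le _ 0))// subr0.
  by rewrite distrC.
move=> /measure_negligible-/(_ measurableT) muT.
have := probability_setT mu; rewrite [LHS]muT => /eqP.
by rewrite eq_sym onee_eq0.
Qed.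

End slabs.

(** A determinant of 1 or -1 is a unit in the integers, so the inverse map is given by an integer
    matrix as well. *)
Lemma toral_automorphism_inv_continuous {R : realType} {m : nat}
    (F G : torus R m -> torus R m) :
  toral_automorphism F -> cancel F G -> continuous G.
Proof.
move=> [M detM ->] MG.
have uM : M \in unitmx by rewrite unitmxE; case: detM => ->; rewrite ?unitrN unitr1.
suff -> : G = toral_map (invmx M) by exact: toral_map_continuous.
apply/funext => x; have [v ->] := tproj_surj x.
rewrite -[RHS]MG; congr G; rewrite !toral_map_tproj mulmxA -map_mxM mulmxV//.
by rewrite map_mx1 mul1mx.
Qed.

(** * Points whose orbit meets a given set *)

Section orbits.
Context {R : realType} {X : pmetricType R}.
Variables (F G : X -> X).
Hypothesis FG : cancel F G.
Variable U : set X.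

Definition saturation : set X := [set x | exists n, U (iterz F G n x)].

(** Exponents for [x] are those for [F x] plus one. As [Negz k] stands for [-(k+1)], the crossing
    between [Negz 0] and [Posz 0] is treated apart. *)
Lemma saturation_invariant : F @^-1` saturation = saturation.
Proof.
apply/seteqP; split => x /= -[[k|k] Uk].
- by exists (Posz k.+1); rewrite /= -iterS iterSr.
- case: k Uk => [|k] /= Uk; first by exists (Posz 0); rewrite -[x]FG.
  exists (Negz k); suff : U (iter k.+2 G (F x)) by rewrite iterSr FG.
  exact: Uk.
- case: k Uk => [|k] Uk; first by exists (Negz 0) => /=; rewrite FG.
  by exists (Posz k); move: Uk; rewrite /= -iterS iterSr.
- by exists (Negz k.+1); suff : U (iter k.+2 G (F x)) by []; rewrite iterSr FG.
Qed.

Lemma saturation_open : continuous F -> continuous G -> open U -> open saturation.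
Proof.
move=> cF cG oU.
have itc (H : X -> X) k : continuous H -> continuous (iter k H).
  move=> cH; elim: k => [|k IH] x; first exact: cvg_id.
  by apply: continuous_comp; [exact: IH|exact: cH].
have -> : saturation = \bigcup_n (iterz F G n) @^-1` U.
  by apply/seteqP; split=> x [n]; exists n.
apply: bigcup_open => n _; apply: open_comp => // x _.
by case: n => k; exact: itc.
Qed.

End orbits.

(** * Connected open neighbourhoods of small measure *)

Section small_connected_neighbourhood.
Context {R : realType} {m : nat} (i0 i1 : 'I_m).
Hypothesis i01 : i0 != i1.
Local Notation T := (torus R m).
Local Notation B := (borel T).
Variable mu : probability (borel (torus R m)) R.
Hypothesis hmu : haar_measure mu.

(** Since [Z] is closed, its neighbourhoods of radius [1/(p+1)] decrease to [Z] itself. *)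
Lemma null_closed_nbhs_small (Z : set T) (e : R) : closed Z -> mu Z = 0%E -> 0 < e ->
  exists p, (mu (\bigcup_(z in Z) ball z (p.+1%:R^-1 : R)) < e%:E)%E.
Proof.
move=> cZ Z0 e0.
pose V (p : nat) : set B := \bigcup_(z in Z) ball (z : T) (p.+1%:R^-1 : R).
have mV p : measurable (V p).
  by apply: borel_open; apply: bigcup_open => z _; exact: open_ball_torus.
apply: (@small_measure_bigcap _ B R mu V e mV) => //.
- move=> p q pq; apply/subsetPset; apply: subset_bigcup => z _.
  by apply: le_ball; rewrite lef_pV2 ?posrE ?ltr0n// ler_nat ltnS.
- rewrite -Z0; congr (mu _); apply/seteqP; split => [x Vx|x Zx p _]; last first.
    by exists x => //; exact: ballxx.
  apply: contrapT => nZx; have := closed_openC cZ.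
  move=> /open_torusP/(_ _ nZx)[r r0 rZ].
  have [p _ pP] := near_infty_natSinv_lt (PosNum r0).
  have [z Zz xz] := Vx p I; apply: (rZ z) => //; apply: ball_sym.
  by apply: le_ball xz; apply/ltW/pP => /=.
Qed.

(* The n slabs normal to [i0] with spacing 1/n; as a preimage under x |-> n x
   they have together the measure of a single slab n times as thick. *)
Let slab_comb (n : nat) (r : R) : set T :=
  toral_map (n%:Z)%:M @^-1` slab i0 0 r.

Lemma toral_map_scalar (n : nat) v :
  toral_map (n%:Z)%:M (tproj v) = tproj (n%:R *: v) :> T.
Proof. by rewrite toral_map_tproj map_scalar_mx mul_scalar_mx. Qed.

Lemma measure_slab_comb n r : (0 < n)%N -> mu (slab_comb n r) = mu (slab i0 0 r).
Proof.
move=> n0; apply: haar_invariant_endo => //.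
- exact: toral_mapD.
- exact: toral_map_continuous.
- move=> y; have [v ->] := tproj_surj y; exists (tproj (n%:R^-1 *: v)).
  by rewrite toral_map_scalar scalerA mulfV ?scale1r// pnatr_eq0 -lt0n.
- by apply: borel_open; exact: slab_open.
Qed.

Lemma slab_sub_comb n (j : int) r : (0 < n)%N ->
  slab i0 (j%:~R / n%:R) (r / n%:R) `<=` slab_comb n r.
Proof.
move=> n0 _ [v /= vr <-]; have nR : 0 < n%:R :> R by rewrite ltr0n.
rewrite /slab_comb /= toral_map_scalar; apply/slab_tproj; rewrite mxE subr0.
apply: le_lt_trans (dZ_le _ j) _.
rewrite -(ltr_pM2l nR) [ltRHS]mulrC divfK ?gt_eqF// -{1}(gtr0_norm nR) -normrM in vr.
by move: vr; rewrite mulrBr [X in _ - X]mulrC divfK ?gt_eqF.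
Qed.

(* [slab i1] links the components, and the slabs normal to [i0] with spacing at
   most the radius of the balls link each ball to [slab i1]. *)
Lemma connected_nbhs_small (Z : set T) (k : nat) (e : R) :
  closed Z -> mu Z = 0%E -> 0 < e -> (0 < k)%N ->
  exists A : set T, [/\ open A, connected A, Z `<=` A,
    slab i1 0 k.*2%:R^-1 `<=` A &
    (mu A < (k%:R^-1 + k%:R^-1 + e)%:E)%E].
Proof.
move=> cZ Z0 e0 k0; have [p pe] := null_closed_nbhs_small cZ Z0 e0.
set V := \bigcup_(z in Z) _ in pe; set r := k.*2%:R^-1 : R.
have r0 : 0 < r by rewrite invr_gt0 ltr0n double_gt0.
have nR : 0 < p.+1%:R :> R by rewrite ltr0n.
pose U := slab i1 0 r : set T.
(* The hyperplane with coordinate [j z / (p+1)] is the last of the comb at or below [z], hence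
   closer to [z] than the radius of the ball. *)
pose j (z : T) : int := Num.floor (p.+1%:R * (repr z) i0 0).
pose W z : set T := slab i0 ((j z)%:~R / p.+1%:R) (r / p.+1%:R) `|`
  ball z (p.+1%:R^-1 : R).
(* Every piece contains [U], which makes the union connected; the separate copy of [U] covers the
   case of an empty [Z]. *)
pose A := U `|` \bigcup_(z in Z) (U `|` W z).
have oW z : open (W z) by apply: openU; [exact: slab_open|exact: open_ball_torus].
have oU : open U by exact: slab_open.
have oA : open A.
  by apply: openU => //; apply: bigcup_open => z _; exact: openU.
have cUW z : connected (U `|` W z).
  have zE : z = tproj (repr z) by rewrite /tproj reprK.
  have near : `|(repr z) i0 0 - (j z)%:~R / p.+1%:R| < p.+1%:R^-1.
    have /andP[j1 j2] : (j z)%:~R <= p.+1%:R * (repr z) i0 0 < (j z)%:~R + 1.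
      by rewrite Num.Theory.floor_le -(intrD _ _ 1) Num.Theory.floorD1_gt.
    have -> : (repr z) i0 0 - (j z)%:~R / p.+1%:R =
        (p.+1%:R * (repr z) i0 0 - (j z)%:~R) / p.+1%:R by field; rewrite gt_eqF.
    rewrite ger0_norm ?divr_ge0 ?subr_ge0// ?ltW// -[ltRHS]mul1r.
    by rewrite ltr_pM2r ?invr_gt0//; lra.
  apply: connectedU; [|exact: slab_connected|apply: connectedU].
  (* As [i0] and [i1] differ, coordinate [i0] can be put on the slab while coordinate [i1] stays 0,
     inside [U]. *)
  - exists (tproj (\col_l if l == i0 then (j z)%:~R / p.+1%:R else 0)).
    split; last left; apply/slab_tproj; rewrite mxE.
      by rewrite eq_sym (negbTE i01) subrr dZ_int ?rpred0.
    by rewrite eqxx subrr dZ_int ?rpred0// divr_gt0.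
  (* Moving only coordinate [i0] of [z] onto the slab stays inside the ball. *)
  - exists (tproj (\col_l if l == i0 then (j z)%:~R / p.+1%:R
                   else (repr z) l 0)); split.
      by apply/slab_tproj; rewrite mxE eqxx subrr dZ_int ?rpred0// divr_gt0.
    rewrite ballEmdist/= {1}zE mdist_tproj.
    apply: bigmax_lt => [|l _]; first by rewrite invr_gt0.
    rewrite mxE; case: eqP => [->|_]; last by rewrite subrr dZ_int ?rpred0// invr_gt0.
    by rewrite (le_lt_trans (dZ_le _ 0))// subr0.
  - exact: slab_connected.
  - exact: ball_torus_connected.
exists A; split => //.
- rewrite /A; have [->|/set0P[z Zz]] := eqVneq Z set0.
    by rewrite bigcup_set0 setU0; exact: slab_connected.
  have U0 : U (tproj 0) by apply/slab_tproj; rewrite mxE subrr dZ_int ?rpred0.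
  apply: connectedU; first by exists (tproj 0); split => //; exists z => //; left.
    exact: slab_connected.
  by apply: bigcup_connected => //; exists (tproj 0) => z' _; left.
- by move=> z Zz; right; exists z => //; right; right; apply: ballxx; rewrite invr_gt0.
- by move=> x Ux; left.
have mU : measurable (U : set B) by exact: borel_open.
have mC : measurable (slab_comb p.+1 r : set B).
  apply: borel_open; have /continuousP := @toral_map_continuous R m (p.+1%:Z)%:M.
  by apply; exact: slab_open.
have mV : measurable (V : set B).
  by apply: borel_open; apply: bigcup_open => z _; exact: open_ball_torus.
(* However many points [Z] has, all the slabs used lie in one comb, of measure at most [1/k]. *)
apply: (@le_lt_trans _ _ (mu (U `|` slab_comb p.+1 r `|` V))).
  apply: le_measure; rewrite ?inE; first exact: borel_open.
    by apply: measurableU => //; exact: measurableU.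
  move=> x [Ux|[z Zz [Ux|[Cx|Bx]]]]; [by left; left|by left; left| |].
    by left; right; exact: slab_sub_comb Cx.
  by right; exists z.
apply: le_lt_trans (measureU2 _ _ _) _ => //; first exact: measurableU.
rewrite EFinD; apply: (@le_lt_trans _ _ ((k%:R^-1 + k%:R^-1)%:E + mu V)%E).
  apply: leeD => //; apply: le_trans (measureU2 _ _ _) _ => //.
  rewrite EFinD; apply: leeD; first exact: measure_slab_le.
  suff : (mu (slab_comb p.+1 r) <= (k%:R^-1)%:E)%E by [].
  rewrite (measure_slab_comb r (ltn0Sn p)); exact: measure_slab_le.
by rewrite lteD2lE.
Qed.

End small_connected_neighbourhood.

Theorem theorem4p10 (R : realType) (m : nat) (hm : (2 <= m)%N)
    (mu : probability (borel (torus R m)) R) (hmu : haar_measure mu)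
    (T : torus R m -> torus R m) (hT : generalized_pisot T) :
  property_S mu T.
Proof.
have [autT [G [TG GT _]]] := hT.
have sT y : exists x, T x = y by exists (G y).
have cG := toral_automorphism_inv_continuous autT TG.
have [M _ TM] := autT.
have TD : {morph T : x y / x + y} by rewrite TM; exact: toral_mapD.
have cT : continuous T by rewrite TM; exact: toral_map_continuous.
have ergT : ergodic mu T.
  (* The ergodicity lemma is stated in dimension [n.+1], where square matrices form a nontrivial
     ring. *)
  by case: m hm mu hmu T hT {autT G TG GT sT cG M TM TD cT} => // n *;
    exact: generalized_pisot_ergodic.
split.
  split => //; first exact: torus_compact.
  exact: haar_invariant_endo.
exists G; split => // eps eps0.
(* Two terms below [eps / 4], for [U] and the comb, and [eps / 2] for the balls add up to less than
   [eps]. *)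
have [k _ kP] : \forall k \near \oo, k.+1%:R^-1 < eps / 4.
  by apply: (near_infty_natSinv_lt (PosNum (_ : 0 < eps / 4))); rewrite divr_gt0.
have {kP} ke : k.+1%:R^-1 < eps / 4 by apply: kP => /=.
pose i0 : 'I_m := Ordinal (ltnW hm); pose i1 : 'I_m := Ordinal hm.
pose U := slab i1 0 k.+1.*2%:R^-1 : set (torus R m).
have r0 : 0 < k.+1.*2%:R^-1 :> R by rewrite invr_gt0 ltr0n.
pose S := saturation T G U.
have oS : open S by apply: saturation_open => //; exact: slab_open.
have mS : measurable (S : set (borel (torus R m))) by exact: borel_open.
(* The invariant set [S] contains [U], which has positive measure, so ergodicity leaves only the
   value 1. *)
have S1 : mu S = 1%E.
  have [S0|//] := ergT S mS (saturation_invariant TG U).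
  have US : (mu U <= mu S)%E.
    apply: le_measure; rewrite ?inE//; first by apply: borel_open; exact: slab_open.
    by move=> x Ux; exists (Posz 0).
  by move: US; rewrite S0 measure_le0 => US; case/negP: (measure_slab_gt0 hmu i1 0 r0).
have Z0 : mu (~` S) = 0%E.
  by rewrite probability_setC// S1 subee.
have e20 : 0 < eps / 2 by rewrite divr_gt0.
have [A [oA cA ZA UA muA]] :=
  @connected_nbhs_small R m i0 i1 isT mu hmu (~` S) k.+1 _ (open_closedC oS) Z0 e20 isT.
exists A; split=> //.
  by apply: lt_le_trans muA _; rewrite lee_fin; move: (k.+1%:R^-1) ke => t ?; lra.
(* A point of [S] has an iterate in [U], hence in [A]; a point outside [S] is in [A] at time 0. *)
rewrite (_ : [set x | _] = set0); first exact: countable0.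
apply/seteqP; split=> // x; apply.
have [[n Un]|nSx] := pselect (S x); first by exists n; exact: UA.
by exists (Posz 0); exact: ZA.
Qed.
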